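(* Let $P$ be a finite poset, let $\alpha,\beta:P\to[0,\infty)$ be order-decreasing, and let $$A=VD_\alpha W,\qquad B=\tilde V D_\beta\tilde W$$ be singular value decompositions of matrices in $\mathbb{C}^{P\times P}$ (with $V,W,\tilde V,\tilde W$ unitary). If $C:=W\tilde V\in\overline{\mathcal{L}(P)\,\mathcal{U}(P)}$, then $$\sigma(AB)\prec_{\log}\lambda(D_{\alpha\beta})\prec_{\log}\sigma(A)*\sigma(B),$$ where $D_{\alpha\beta}$ is the diagonal matrix with diagonal entries $\big(\alpha(x)\beta(x)\big)_{x\in P}$.
   Context: Matrices in $\mathbb{C}^{P\times P}$ have rows and columns indexed by the finite set $P$. For $f:P\to\mathbb{R}$, $D_f\in\mathbb{C}^{P\times P}$ is the diagonal matrix with diagonal entries $(f(x))_{x\in P}$. A function $f:P\to\mathbb{R}$ on a poset is order-decreasing if $x\le y$ implies $f(x)\ge f(y)$. In the singular value decompositions, the singular values are labeled by $\alpha$ and $\beta$ and need not be listed in decreasing order along any particular enumeration of $P$. For a finite poset $P$, $$\mathcal{L}(P):=\{L\in\mathbb{C}^{P\times P}\mid L_{xy}=0\text{ unless }y\le x\},\qquad \mathcal{U}(P):=\{U\in\mathbb{C}^{P\times P}\mid U_{xy}=0\text{ unless }x\le y\},$$ $\mathcal{L}(P)\,\mathcal{U}(P)=\{LU\mid L\in\mathcal{L}(P),U\in\mathcal{U}(P)\}$, and the bar denotes the closure in the norm topology. $\sigma(X)$ is the vector of singular values of $X$ in decreasing order, and $\lambda(X)$ is the vector of eigenvalues of a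 Hermitian $X$ in decreasing order (both with multiplicity). $x*y$ denotes componentwise multiplication of vectors. For $x,y\in\mathbb{R}^d$ with nonnegative entries, $x\prec_{\log}y$ means $\prod_{i=1}^k x_i^\downarrow\le\prod_{i=1}^k y_i^\downarrow$ for all $k\in\{1,\dots,d\}$ with equality for $k=d$, where $\downarrow$ denotes decreasing rearrangement. *)

(* Defs.v *)
From HB Require Import structures.
From mathcomp Require Import all_boot all_order all_algebra spectral complex.
From mathcomp Require Import all_classical all_reals all_analysis.

Set Implicit Arguments.
Unset Strict Implicit.
Unset Printing Implicit Defensive.

Import Order.TTheory GRing.Theory Num.Theory.
Import numFieldNormedType.Exports.

Local Open Scope classical_set_scope.
Local Open Scope ring_scope.
Local Open Scope complex_scope.
Local Open Scope sesquilinear_scope.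

(* A matrix indexed by a finite type P is a square matrix of size #|P|;
   the row or column of x : P is the one of index [enum_rank x]. *)
Notation "''M_C' [ R , P ]" := 'M[R[i]]_#|P|
  (at level 0, R at level 200, P at level 200, format "''M_C' [ R ,  P ]").

Section PosetMatrices.
Variables (R : realType) (d : Order.disp_t) (P : finPOrderType d).

Definition order_decreasing (f : P -> R) : Prop :=
  forall x y : P, (x <= y)%O -> f y <= f x.

Definition diag_fun (f : P -> R) : 'M_C[R, P] :=
  diag_mx (\row_j (f (enum_val j))%:C).

Definition lower_mx : set 'M_C[R, P] :=
  [set L | forall x y : P, ~~ (y <= x)%O -> L (enum_rank x) (enum_rank y) = 0].

Definition upper_mx : set 'M_C[R, P] :=
  [set U | forall x y : P, ~~ (x <= y)%O -> U (enum_rank x) (enum_rank y) = 0].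

Definition lower_upper_mx : set 'M_C[R, P] :=
  [set L *m U | L in lower_mx & U in upper_mx].

End PosetMatrices.

Arguments lower_upper_mx R {d} P.

Section MatrixClosure.
Variables (R : realType) (n : nat).

(* The type constraint selects the field topology of R[i]; matrices get the
   entrywise topology, i.e. that of any matrix norm. *)
Definition mx_closure (S : set 'M[R[i]]_n) : set 'M[R[i]]_n :=
  closure (S : set 'M[R[i] : numFieldType]_n).

Lemma mx_closureP (S : set 'M[R[i]]_n) (X : 'M[R[i]]_n) :
  mx_closure S X <-> forall e : R, 0 < e ->
    exists2 Y, S Y & forall i j, `|X i j - Y i j| < e%:C.
Proof.
split=> [H e e0|H B /nbhs_ballP[e /= e0 eB]].
  have [|Y [SY [_ XY]]] := H (@ball _ 'M[R[i] : numFieldType]_n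
      (X : 'M[R[i] : numFieldType]_n) (e%:C : (R[i] : numFieldType))).
    by apply: nbhsx_ballx; rewrite ltcR.
  by exists Y => // i j; apply: XY.
have ee1 : e = (complex.Re e)%:C.
  by case: e e0 {eB} => a b; rewrite ltcE /= => /andP[/eqP -> _].
have [|Y SY XY] := H (complex.Re e); first by rewrite -ltcR -ee1.
exists Y; split=> //; apply: eB; split=> // i j; rewrite /ball /= ee1.
exact: XY.
Qed.

End MatrixClosure.

Section Spectra.
Variables (R : realType) (n : nat).

Definition decr_rearr (x : 'rV[R]_n) : 'rV[R]_n :=
  \row_i (sort >=%R [seq x 0 j | j <- enum 'I_n])`_i.

(* The roots of the characteristic polynomial, with multiplicity. *)
Definition eigenvalues (X : 'M[R[i]]_n) : seq R[i] :=
  sval (closed_field_poly_normal (char_poly X)).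

Lemma eigenvaluesE (X : 'M[R[i]]_n) :
  char_poly X = \prod_(z <- eigenvalues X) ('X - z%:P).
Proof.
rewrite /eigenvalues; case: closed_field_poly_normal => r /=.
by rewrite (monicP (char_poly_monic X)) scale1r.
Qed.

Lemma size_eigenvalues (X : 'M[R[i]]_n) : size (eigenvalues X) = n.
Proof.
have := size_char_poly X.
by rewrite eigenvaluesE size_prod_XsubC; case.
Qed.

(* For Hermitian X, whose eigenvalues are real, so that nothing is lost by
   taking real parts; decreasing order, with multiplicity. *)
Definition herm_eigenvalues (X : 'M[R[i]]_n) : 'rV[R]_n :=
  decr_rearr (\row_i complex.Re (eigenvalues X)`_i).

(* Decreasing, since the square root is monotone. *)
Definition singular_values (X : 'M[R[i]]_n) : 'rV[R]_n :=
  map_mx Num.sqrt (herm_eigenvalues (X ^t* *m X)).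

(* Intended for vectors with nonnegative entries. *)
Definition log_majorized (x y : 'rV[R]_n) : Prop :=
  (forall k : nat, (1 <= k <= n)%N ->
     \prod_(i < n | (i < k)%N) decr_rearr x 0 i
       <= \prod_(i < n | (i < k)%N) decr_rearr y 0 i)
  /\ \prod_(i < n) decr_rearr x 0 i = \prod_(i < n) decr_rearr y 0 i.

End Spectra.

(* Main.v *)
(* The products of the k largest squared singular values are handled through
   Gram determinants: gram Q = det (Q^* Q) for an n x k matrix Q, and X satisfies
   [gram_bound k X c] when gram (X Q) <= c gram Q for all Q. The best such c is
   the product of the k largest eigenvalues of X^* X, and bounds multiply.

   Let F = D_alpha, G = D_beta. If C = L U, monotonicity of alpha and beta gives
   F^t L U G^t = L_t (F G)^t U_t, where the entries of L_t and U_t are dominated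
   by those of L and U; so the best bound a_t of F^t C G^t is at most K m^t, with
   K independent of t and m the bound of F G. On the other hand, comparing the
   nonzero spectra of X Y and Y X yields a_t^2 <= b a_(2t), with b a bound of C^*.
   Iterating along t = 2^j and letting j go to infinity removes K: a_1 <= b m.
   This inequality passes to the closure by continuity, and b = 1 if C is
   unitary. *)

Require Import Defs.
From HB Require Import structures.
From mathcomp Require Import all_boot all_order all_fingroup.
From mathcomp Require Import all_algebra spectral complex.
From mathcomp Require Import all_classical all_reals all_analysis.

Set Implicit Arguments.
Unset Strict Implicit.
Unset Printing Implicit Defensive.

Import Order.TTheory GRing.Theory Num.Theory.
Import numFieldNormedType.Exports.

Local Open Scope ring_scope.

(** * The Cauchy-Binet formula *)

Section CauchyBinet.
Variables (R : comNzRingType) (k n : nat) (A : 'M[R]_(k, n)) (B : 'M[R]_(n, k)).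

(** Multilinearity in the rows: row [i] of [A *m B] is a combination of the rows of [B], and [f i]
    is the row picked from it. *)
Lemma det_mulmx_expand :
  \det (A *m B) =
  \sum_(f : {ffun 'I_k -> 'I_n}) (\prod_i A i (f i)) * \det (rowsub f B).
Proof.
transitivity (\sum_(s : 'S_k) \sum_(f : {ffun 'I_k -> 'I_n})
    (-1) ^+ s * \prod_i (A i (f i) * B (f i) (s i))).
  apply: eq_bigr => s _; rewrite -big_distrr /=; congr (_ * _).
  rewrite -(bigA_distr_bigA (fun i j => A i j * B j (s i))).
  by apply: eq_bigr => i _; rewrite mxE.
rewrite exchange_big; apply: eq_bigr => f _; rewrite big_distrr /=.
apply: eq_bigr => s _; rewrite big_split /= mulrCA; congr (_ * (_ * _)).
by apply: eq_bigr => i _; rewrite mxE.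
Qed.

(* The sum runs over all maps instead of the k-subsets, hence the factor k!. *)
Lemma cauchy_binet :
  \det (A *m B) *+ k`! =
  \sum_(f : {ffun 'I_k -> 'I_n}) \det (colsub f A) * \det (rowsub f B).
Proof.
rewrite -card_Sn -sumr_const.
transitivity (\sum_(s : 'S_k) \sum_(f : {ffun 'I_k -> 'I_n})
    (-1) ^+ s * (\prod_i A i (f (s i))) * \det (rowsub f B)).
  (* Copy [s] of the determinant is reindexed by [f] composed with [s]; permuting the rows of
     [rowsub f B] produces the sign. Summing over [s] then assembles [\det (colsub f A)]. *)
  apply: eq_bigr => s _; rewrite det_mulmx_expand.
  pose h (t : 'S_k) (f : {ffun 'I_k -> 'I_n}) := [ffun i => f (t i)].
  rewrite (reindex (h s)) /=; last first.
    exists (h s^-1%g) => f _; apply/ffunP => i;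
    by rewrite !ffunE ?permK ?permKV.
  apply: eq_bigr => f _; rewrite [RHS]mulrAC [RHS]mulrC; congr (_ * _).
    by apply: eq_bigr => i _; rewrite ffunE.
  rewrite -det_perm -det_mulmx -row_permE; congr (\det _).
  by apply/matrixP => i j; rewrite !mxE ffunE.
rewrite exchange_big; apply: eq_bigr => f _; rewrite big_distrl /=.
apply: eq_bigr => s _; congr (_ * _ * _).
by apply: eq_bigr => i _; rewrite mxE.
Qed.

End CauchyBinet.

(** * Gram determinants, their bounds, and the spectrum of [X ^t* *m X] *)

Section Gram.
Local Open Scope sesquilinear_scope.
Variable C : numClosedFieldType.

Lemma det_conjT k (T : 'M[C]_k) : \det (T ^t*) = (\det T)^*.
Proof. by rewrite det_map_mx det_tr. Qed.

Lemma conjT_mul m n p (A : 'M[C]_(m, n)) (B : 'M[C]_(n, p)) :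
  (A *m B) ^t* = B ^t* *m A ^t*.
Proof. by rewrite trmx_mul map_mxM. Qed.

Definition gram n k (Y : 'M[C]_(n, k)) : C := \det (Y ^t* *m Y).

Lemma gram_mulr n k (Y : 'M[C]_(n, k)) (T : 'M[C]_k) :
  gram (Y *m T) = gram Y * `|\det T| ^+ 2.
Proof.
rewrite /gram conjT_mul -mulmxA (mulmxA _ Y T) !det_mulmx det_conjT.
by rewrite normCK mulrCA mulrA mulrAC mulrA.
Qed.

Lemma gram_unitary n k (U : 'M[C]_n) (Q : 'M[C]_(n, k)) :
  U \is unitarymx -> gram (U *m Q) = gram Q.
Proof.
by rewrite -trmxC_unitary => /unitarymxP; rewrite trmxCK /gram => UU;
  rewrite conjT_mul -mulmxA (mulmxA _ U) UU mul1mx.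
Qed.

Lemma det_rowsub_noninj n k (f : {ffun 'I_k -> 'I_n}) (Q : 'M[C]_(n, k)) :
  ~~ injectiveb f -> \det (rowsub f Q) = 0.
Proof.
move=> /injectivePn [i [j ij fij]].
by apply: (determinant_alternate ij) => l; rewrite !mxE fij.
Qed.

Lemma det_colsub_conjT n k (f : {ffun 'I_k -> 'I_n}) (Q : 'M[C]_(n, k)) :
  \det (colsub f (Q ^t*)) = (\det (rowsub f Q))^*.
Proof.
by rewrite -det_conjT; congr (\det _); apply/matrixP => i j; rewrite !mxE.
Qed.

Lemma gram_cauchy_binet n k (Q : 'M[C]_(n, k)) :
  gram Q *+ k`! =
  \sum_(f : {ffun 'I_k -> 'I_n}) `|\det (rowsub f Q)| ^+ 2.
Proof.
rewrite cauchy_binet; apply: eq_bigr => f _.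
by rewrite det_colsub_conjT normCKC.
Qed.

Lemma gram_ge0 n k (Q : 'M[C]_(n, k)) : 0 <= gram Q.
Proof.
rewrite -(pmulrn_lge0 _ (fact_gt0 k)) gram_cauchy_binet.
by apply: sumr_ge0 => f _; exact: exprn_ge0.
Qed.

(** After multiplication by k!, both sides are combinations of [|\det (rowsub f Q)| ^+ 2] over all
    maps [f]. Non-injective maps contribute 0, so bounding the weights of the injective ones
    suffices. *)
Lemma det_diag_compression_le n k (s : 'rV[C]_n) (Q : 'M[C]_(n, k)) c :
  (forall f : {ffun 'I_k -> 'I_n}, injective f -> \prod_i s 0 (f i) <= c) ->
  \det (Q ^t* *m diag_mx s *m Q) <= c * gram Q.
Proof.
move=> sc; have := lerMn2r k`! (\det (Q ^t* *m diag_mx s *m Q)) (c * gram Q).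
rewrite eqn0Ngt fact_gt0 /= => <-.
rewrite -mulrnAr gram_cauchy_binet cauchy_binet mulr_sumr.
apply: ler_sum => f _.
have [/injectiveP finj|/det_rowsub_noninj ->] := boolP (injectiveb f);
  last first.
  by rewrite normr0 mulr0 expr0n mulr0.
have -> : colsub f (Q ^t* *m diag_mx s) =
    colsub f (Q ^t*) *m diag_mx (\row_i s 0 (f i)).
  by apply/matrixP => i j; rewrite mxE !mul_mx_diag !mxE.
rewrite det_mulmx det_diag det_colsub_conjT mulrAC -normCKC mulrC.
rewrite ler_wpM2r ?exprn_ge0//.
by under eq_bigr do rewrite mxE; exact: sc.
Qed.

Lemma norm_det_unitary n (U : 'M[C]_n) :
  U \is unitarymx -> `|\det U| = 1.
Proof.
move=> /unitarymxP/(congr1 determinant); rewrite det_mulmx det_conjT det1 -normCK.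
by move/eqP; rewrite sqrp_eq1// => /eqP.
Qed.

(** [U] intertwines the two characteristic matrices; taking determinants, the nonzero constant
    [\det U] cancels. *)
Lemma char_poly_unitary_conj n (X D U : 'M[C]_n) :
  U \is unitarymx -> X = U ^t* *m D *m U -> char_poly X = char_poly D.
Proof.
move=> Uu XE; have UX : U *m X = D *m U.
  by rewrite XE !mulmxA (unitarymxP Uu) mul1mx.
have detU : (\det (map_mx polyC U) : {poly C}) != 0.
  by rewrite det_map_mx polyC_eq0 -unitfE -unitmxE unitarymx_unit.
apply: (mulfI detU); rewrite /char_poly -det_mulmx [RHS]mulrC -det_mulmx.
congr (\det _); rewrite /char_poly_mx mulmxBr mulmxBl -!map_mxM UX.
by rewrite scalar_mxC.
Qed.

Section GramBound.
Variables (n k : nat).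
Implicit Types (X Y U : 'M[C]_n) (a b c : C).

(** [gram Q] is the squared norm of the exterior product of the columns of [Q]; for [k <= n] the
    least such [c] is the squared norm of the [k]-th exterior power of [X]. *)
Definition gram_bound X c :=
  forall Q : 'M[C]_(n, k), gram (X *m Q) <= c * gram Q.

(** A certificate from below: the independent columns of [Q] span an invariant subspace of
    [X ^t* *m X], [T] is the matrix of the restriction, and [a] is the product of its
    eigenvalues. *)
Definition gram_eigen X a := exists (Q : 'M[C]_(n, k)) (T : 'M[C]_k),
  [/\ X ^t* *m X *m Q = Q *m T, gram Q = 1 & \det T = a].

Lemma gram_boundM X Y a b :
  0 <= a -> gram_bound X a -> gram_bound Y b -> gram_bound (X *m Y) (a * b).
Proof.
move=> a0 Xa Yb Q; rewrite -mulmxA (le_trans (Xa _))// -mulrA.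
by rewrite ler_wpM2l.
Qed.

Lemma gram_bound_unitaryM U X V c : U \is unitarymx -> V \is unitarymx ->
  gram_bound X c -> gram_bound (U *m X *m V) c.
Proof.
move=> Uu Vu Xc Q; rewrite -!mulmxA gram_unitary// (le_trans (Xc _))//.
by rewrite gram_unitary.
Qed.

Lemma gram_bound_eigen X a c : gram_bound X c -> gram_eigen X a -> a <= c.
Proof.
move=> Xc [Q [T [XQ Q1 <-]]]; have := Xc Q; rewrite Q1 mulr1; apply: le_trans.
by rewrite /gram conjT_mul -mulmxA mulmxA mulmxA -mulmxA -mulmxA (mulmxA _ X) XQ
  mulmxA det_mulmx -/(gram Q) Q1 mul1r.
Qed.

Lemma spectral_gramian X : exists (U : 'M[C]_n) (s : 'rV[C]_n),
  [/\ U \is unitarymx, X ^t* *m X = U ^t* *m diag_mx s *m U &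
      forall i, 0 <= s 0 i].
Proof.
have /orthomx_spectralP XE : X ^t* *m X \is normalmx.
  by apply/normalmxP; rewrite conjT_mul trmxCK.
have Uu := spectral_unitarymx (X ^t* *m X).
set U := spectralmx _ in XE Uu; set s := spectral_diag _ in XE.
rewrite invmx_unitary// in XE.
exists U, s; split=> // i.
(* Each entry of [s] is the squared norm of a column of [X *m U ^t*]. *)
have sE : diag_mx s = (X *m U ^t*) ^t* *m (X *m U ^t*).
  rewrite conjT_mul trmxCK -mulmxA (mulmxA _ X) XE !mulmxA (unitarymxP Uu) mul1mx.
  by rewrite -mulmxA (unitarymxP Uu) mulmx1.
move/matrixP: sE => /(_ i i); rewrite !mxE eqxx mulr1n => ->.
by apply: sumr_ge0 => j _; rewrite !mxE -normCKC exprn_ge0.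
Qed.

Lemma gram_bound_spectral X U (s : 'rV[C]_n) c : U \is unitarymx ->
  X ^t* *m X = U ^t* *m diag_mx s *m U ->
  (forall f : {ffun 'I_k -> 'I_n}, injective f -> \prod_i s 0 (f i) <= c) ->
  gram_bound X c.
Proof.
move=> Uu XE sc Q.
rewrite -(gram_unitary Q Uu); apply: le_trans (det_diag_compression_le _ sc).
rewrite /gram !conjT_mul !mulmxA -(mulmxA _ _ X) XE.
by rewrite -!mulmxA.
Qed.

(** The columns of [U ^t*] selected by [f] are orthonormal eigenvectors of [X ^t* *m X]. *)
Lemma gram_eigen_spectral X U (s : 'rV[C]_n) (f : 'I_k -> 'I_n) :
  U \is unitarymx -> X ^t* *m X = U ^t* *m diag_mx s *m U ->
  injective f -> gram_eigen X (\prod_i s 0 (f i)).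
Proof.
move=> Uu XE fI; exists (colsub f (U ^t*)), (diag_mx (\row_i s 0 (f i))).
have UQ : U *m colsub f (U ^t*) = colsub f 1%:M.
  by rewrite -(unitarymxP Uu); apply/matrixP => i j; rewrite !mxE;
    apply: eq_bigr => l _; rewrite !mxE.
split.
- rewrite XE -mulmxA UQ; apply/matrixP => i j.
  rewrite -mulmxA !mul_mx_diag !mxE (bigD1 (f j)) //= big1 => [|l lj].
    by rewrite mul_diag_mx !mxE eqxx mulr1 addr0.
  by rewrite mul_diag_mx !mxE (negPf lj) mulr0n mulr0 mulr0.
- rewrite -(gram_unitary _ Uu) UQ /gram.
  suff -> : (colsub f 1%:M)^t* *m colsub f (1%:M : 'M[C]_n) = 1%:M by rewrite det1.
  apply/matrixP => i j; rewrite !mxE (bigD1 (f j)) //= big1 => [|l lj].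
    by rewrite !mxE eqxx mulr1 addr0 (inj_eq fI) eq_sym conjC_nat.
  by rewrite !mxE (negPf lj) mulr0.
- by rewrite det_diag; apply: eq_bigr => i _; rewrite mxE.
Qed.

(** The largest product of entries of [s] over injective maps is a bound, and eigenvectors attain
    it; [k <= n] ensures that an injective map exists. *)
Lemma gram_sharp X : (k <= n)%N ->
  exists a, [/\ 0 <= a, gram_bound X a & gram_eigen X a].
Proof.
move=> kn; have [U [s [Uu XE s0]]] := spectral_gramian X.
pose F (f : {ffun 'I_k -> 'I_n}) := \prod_i s 0 (f i).
have F0 f : 0 <= F f by apply: prodr_ge0.
have f0I : injectiveb [ffun i => widen_ord kn i].
  by apply/injectiveP => i j; rewrite !ffunE => /(congr1 val)/= /val_inj.
have FC : {in (fun f : {ffun 'I_k -> 'I_n} => injectiveb f) &,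
    forall f g, F f >=< F g}.
  by move=> f g _ _; apply: real_comparable; rewrite ger0_real.
have [f /injectiveP fI fmax] := comparable_arg_maxP f0I FC.
exists (F f); split=> //.
- by apply: (gram_bound_spectral Uu XE) => g /injectiveP/fmax.
- exact: (gram_eigen_spectral Uu XE).
Qed.

Lemma unitary_norm_le1 U i j : U \is unitarymx -> `|U i j| <= 1.
Proof.
move=> /unitarymxP/matrixP/(_ i i); rewrite !mxE eqxx => U1.
rewrite -(@expr_le1 _ 2)// -[leRHS]/(true%:R) -U1 (bigD1 j)//= !mxE -normCK lerDl.
by apply: sumr_ge0 => l _; rewrite !mxE -normCK exprn_ge0.
Qed.

Lemma unitary_conj_diag_le U G i :
  U \is unitarymx -> `|(U *m G *m U ^t*) i i| <= \sum_j \sum_l `|G j l|.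
Proof.
move=> Uu; rewrite exchange_big mxE (le_trans (ler_norm_sum _ _ _))//.
apply: ler_sum => l _; rewrite !mxE normrM norm_conjC.
rewrite -[leRHS]mulr1 ler_pM ?unitary_norm_le1//.
rewrite (le_trans (ler_norm_sum _ _ _))//; apply: ler_sum => j _.
by rewrite normrM ler_piMl ?unitary_norm_le1.
Qed.

(** The numbers [s i - c] are the diagonal entries of a unitary conjugate of [X ^t* *m X - c%:M].
    The case [c = 0] is a crude entrywise bound; [c = 1] gives a bound that tends to 1 as the
    Gramian tends to the identity. *)
Lemma gram_bound_dist X c :
  gram_bound X ((`|c| + \sum_i \sum_j `|(X ^t* *m X - c%:M) i j|) ^+ k).
Proof.
have [U [s [Uu XE s0]]] := spectral_gramian X.
apply: (gram_bound_spectral Uu XE) => f _.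
rewrite -[in leRHS](card_ord k) -prodr_const; apply: ler_prod => i _.
rewrite s0 -[leLHS]ger0_norm// -[s 0 _](subrKC c) (le_trans (ler_normD _ _))//.
rewrite lerD2l; have := unitary_conj_diag_le (X ^t* *m X - c%:M) (f i) Uu.
rewrite XE mulmxBr mulmxBl !mulmxA (unitarymxP Uu) mul1mx mulmxtVK//.
by rewrite scalar_mxC mulmxtVK// !mxE eqxx !mulr1n.
Qed.

(* The nonzero eigenvalues of D' (Y^* D^2 Y D') and (Y^* D^2 Y D') D' agree; the
   latter matrix is Y^* times the matrix with squared diagonal factors. *)
Lemma gram_bound_doubling (D D' Y : 'M[C]_n) a b c :
  D ^t* = D -> D' ^t* = D' -> 0 <= a -> 0 <= b -> 0 <= c ->
  gram_eigen (D *m Y *m D') a -> gram_bound (Y ^t*) b ->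
  gram_bound (D *m D *m Y *m (D' *m D')) c -> a ^+ 2 <= b * c.
Proof.
move=> DE D'E a0 b0 c0 [Q [T [QT Q1 Ta]]] Yb Dc.
pose Z := Y ^t* *m (D *m D *m Y *m D') *m Q.
have DZ : D' *m Z = Q *m T.
  by rewrite -QT !conjT_mul DE D'E /Z !mulmxA.
have := gram_boundM b0 Yb Dc Z.
have -> : Y^t* *m (D *m D *m Y *m (D' *m D')) *m Z = Z *m T.
  by rewrite [D *m D *m Y *m _]mulmxA -!mulmxA DZ /Z !mulmxA.
rewrite gram_mulr Ta ger0_norm//.
(* If [gram Z = 0], division is impossible, but the crude bound of [D'] gives [gram (D' *m Z) = 0],
   while this value is [a ^+ 2]. *)
have [Z0 _|Z0] := eqVneq (gram Z) 0.
  have := gram_bound_dist D' 0 Z; rewrite Z0 mulr0 DZ gram_mulr Q1 mul1r Ta.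
  by rewrite ger0_norm// => /le_trans; apply; exact: mulr_ge0.
by rewrite mulrC ler_pM2r// lt0r Z0 gram_ge0.
Qed.

End GramBound.
End Gram.

(** * Entrywise limits of matrix expressions *)

Section EntrywiseLimits.
Local Open Scope classical_set_scope.
Local Open Scope sesquilinear_scope.
Context {K : numClosedFieldType} {T : Type} {F : set_system T} {FF : Filter F}.

Lemma cvg_sumr I (r : seq I) (f : I -> T -> K) (a : I -> K) :
  (forall i, f i x @[x --> F] --> a i) ->
  \sum_(i <- r) f i x @[x --> F] --> \sum_(i <- r) a i.
Proof. by move=> fa; apply: cvg_big => //; exact: add_continuous. Qed.

Lemma cvg_prodr I (r : seq I) (f : I -> T -> K) (a : I -> K) :
  (forall i, f i x @[x --> F] --> a i) ->
  \prod_(i <- r) f i x @[x --> F] --> \prod_(i <- r) a i.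
Proof. by move=> fa; apply: cvg_big => //; exact: mul_continuous. Qed.

Lemma cvg_exprn k (f : T -> K) (a : K) :
  f x @[x --> F] --> a -> f x ^+ k @[x --> F] --> a ^+ k.
Proof.
move=> fa; rewrite -[k]card_ord -prodr_const.
by under eq_cvg do rewrite -prodr_const; apply: cvg_prodr.
Qed.

Lemma cvg_conjC (f : T -> K) (a : K) :
  f x @[x --> F] --> a -> Num.conj (f x) @[x --> F] --> Num.conj a.
Proof.
move=> /cvgrPdist_lt fa; apply/cvgrPdist_lt => e e0.
by apply: filterS (fa e e0) => x; rewrite -rmorphB norm_conjC.
Qed.

Definition mx_cvg (F : set_system T) m n
    (M : T -> 'M[K]_(m, n)) (A : 'M[K]_(m, n)) :=
  forall i j, M x i j @[x --> F] --> A i j.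

Lemma mx_cvg_cst m n (A : 'M[K]_(m, n)) : mx_cvg F (fun=> A) A.
Proof. by move=> i j; exact: cvg_cst. Qed.

Lemma mx_cvgM m n p (M : T -> 'M[K]_(m, n)) (N : T -> 'M[K]_(n, p)) A B :
  mx_cvg F M A -> mx_cvg F N B -> mx_cvg F (fun x => M x *m N x) (A *m B).
Proof.
move=> MA NB i j; rewrite mxE; under eq_cvg do rewrite mxE.
by apply: cvg_sumr => l; apply: cvgM.
Qed.

Lemma mx_cvg_conjT m n (M : T -> 'M[K]_(m, n)) A :
  mx_cvg F M A -> mx_cvg F (fun x => (M x) ^t*) (A ^t*).
Proof.
move=> MA i j; rewrite !mxE; under eq_cvg do rewrite !mxE.
exact: cvg_conjC.
Qed.

Lemma cvg_det n (M : T -> 'M[K]_n) A :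
  mx_cvg F M A -> \det (M x) @[x --> F] --> \det A.
Proof.
move=> MA; apply: cvg_sumr => s; apply: cvgM; first exact: cvg_cst.
by apply: cvg_prodr.
Qed.

Lemma cvg_gram n k (M : T -> 'M[K]_(n, k)) A :
  mx_cvg F M A -> gram (M x) @[x --> F] --> gram A.
Proof. by move=> MA; apply/cvg_det/mx_cvgM => //; exact: mx_cvg_conjT. Qed.

Lemma cvg_entry_norm_sum n (M : T -> 'M[K]_n) A : mx_cvg F M A ->
  \sum_i \sum_j `|M x i j| @[x --> F] --> \sum_i \sum_j `|A i j|.
Proof.
by move=> MA; do 2! (apply: cvg_sumr => ?); apply: cvg_norm.
Qed.

(** The expression is the slack in a Gram inequality whose constant measures how far [M x] is from
    unitary; its nonnegativity is what passes to the closure. *)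
Lemma cvg_gram_defect n k (D D' : 'M[K]_n) (Q : 'M[K]_(n, k)) (c : K)
    (M : T -> 'M[K]_n) (Y : 'M[K]_n) : mx_cvg F M Y ->
  (1 + \sum_i \sum_j `|(M x *m (M x) ^t* - 1%:M) i j|) ^+ k * c
    - gram (D *m M x *m D' *m Q) @[x --> F] -->
  (1 + \sum_i \sum_j `|(Y *m Y ^t* - 1%:M) i j|) ^+ k * c
    - gram (D *m Y *m D' *m Q).
Proof.
move=> MY; apply: cvgB; last first.
  by apply: cvg_gram; do 3! (apply: mx_cvgM => //; try exact: mx_cvg_cst).
apply: cvgM; last exact: cvg_cst.
apply: cvg_exprn; apply: cvgD; first exact: cvg_cst.
apply: cvg_entry_norm_sum => i j; rewrite [_ i j]mxE.
under eq_cvg do rewrite mxE.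
apply: cvgD; last exact: cvg_cst.
by apply: mx_cvgM => //; exact: mx_cvg_conjT.
Qed.

End EntrywiseLimits.

(** * Inequalities obtained in the limit: closures and large powers *)

Section ClosedCondition.
Local Open Scope classical_set_scope.

(** If [h Y < 0], some [X] in [S] has [h X] within [- h Y] of [h Y], hence negative. The order of
    [K] is partial, so excluding [h Y < 0] yields [0 <= h Y] only for real [h Y]. *)
Lemma ge0_closure (K : numClosedFieldType) (T : topologicalType) (S : set T)
    (h : T -> K) (Y : T) :
  closure S Y -> h X @[X --> Y] --> h Y -> (forall X, S X -> 0 <= h X) ->
  h Y \is Num.real -> 0 <= h Y.
Proof.
move=> SY /cvgrPdist_lt hY h0 hreal; rewrite real_leNgt ?real0//.
apply/negP => hlt0; have := hY (- h Y); rewrite oppr_gt0 => /(_ hlt0) /SY.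
move=> [X [/h0 hX]]; rewrite /= distrC.
move=> /(real_ltr_distlDr (realB (ger0_real hX) hreal)).
by rewrite subrr => /(le_lt_trans hX); rewrite ltxx.
Qed.

End ClosedCondition.

(** If [r < a], dividing by powers of [a] bounds [b] by [K] times powers of [r / a], which tend to
    0. *)
Lemma le_of_double_powers (R : realType) (a r b K : R) :
  0 <= a -> 0 <= r -> 0 < b ->
  (forall j, a ^+ (2 ^ j) * b <= K * r ^+ (2 ^ j)) -> a <= r.
Proof.
move=> a0 r0 b0 H; rewrite leNgt; apply/negP => ra.
have a_gt0 : 0 < a by exact: le_lt_trans ra.
have q0 : 0 <= r / a by rewrite divr_ge0.
have q1 : r / a < 1 by rewrite ltr_pdivrMr// mul1r.
have qn : `|r / a| < 1 by rewrite ger0_norm.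
have K0 : 0 < `|K| + 1 by rewrite ltr_wpDl.
(* The added 1 keeps the divisor positive. The threshold [N] is applied at the exponent [2 ^ N],
   which exceeds it. *)
have /cvgrPdist_lt /(_ (b / (`|K| + 1))) := cvg_expr qn.
rewrite divr_gt0// => /(_ isT)[N _ /(_ (2 ^ N)%N)].
rewrite /= (ltnW (ltn_expl _ _))// => /(_ isT).
rewrite sub0r normrN ger0_norm ?exprn_ge0// ltr_pdivlMr//; apply/negP.
rewrite -leNgt -(ler_pM2l (exprn_gt0 (2 ^ N) a_gt0)).
rewrite (le_trans (H N))// mulrA -exprMn mulrCA divff ?gt_eqF// mulr1 mulrC.
by rewrite ler_wpM2l ?exprn_ge0// ler_wpDr// ler_norm.
Qed.

(** * Gram bounds for diagonal scalings of lower-upper products *)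

Section DiagFun.
Local Open Scope complex_scope.
Local Open Scope sesquilinear_scope.
Variables (R : realType) (d : Order.disp_t) (P : finPOrderType d).
Local Notation n := #|P|.
Implicit Types (f g : P -> R).

Lemma diag_fun_conjT f : (diag_fun f) ^t* = diag_fun f.
Proof.
rewrite /diag_fun tr_diag_mx map_diag_mx; congr diag_mx; apply/rowP => i.
by rewrite !mxE; apply/CrealP; rewrite complex_real.
Qed.

Lemma diag_funM f g : diag_fun f *m diag_fun g = diag_fun (fun x => f x * g x).
Proof.
rewrite /diag_fun mulmx_diag; congr diag_mx; apply/rowP => i.
by rewrite !mxE rmorphM.
Qed.

Lemma gram_bound_diag_fun k f (c : R[i]) :
  (forall h : {ffun 'I_k -> 'I_n}, injective h ->
    \prod_i (f (enum_val (h i)) ^+ 2)%:C <= c) ->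
  gram_bound k (diag_fun f) c.
Proof.
move=> fc; apply: (@gram_bound_spectral _ _ _ _ 1%:M
   (\row_j (f (enum_val j) ^+ 2)%:C)).
- by apply/unitarymxP; rewrite trmx1 map_mx1 mulmx1.
- rewrite diag_fun_conjT diag_funM trmx1 map_mx1 mul1mx mulmx1.
  by congr diag_mx; apply/rowP => i; rewrite !mxE expr2.
- by move=> h /fc hc; under eq_bigr do rewrite mxE.
Qed.

(** The bound depends on [Y] alone, so it serves every matrix dominated by [Y]. *)
Lemma gram_bound_entry_le m k (X Y : 'M[R[i]]_m) :
  (forall i j, `|X i j| <= `|Y i j|) ->
  gram_bound k X ((\sum_i \sum_j \sum_l `|Y l i| * `|Y l j|) ^+ k).
Proof.
move=> XY Q; apply: le_trans (gram_bound_dist X 0 Q) _.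
rewrite ler_wpM2r ?gram_ge0// lerXn2r ?nnegrE ?addr_ge0 ?sumr_ge0//.
- by move=> i _; rewrite sumr_ge0.
- by move=> i _; do 2! (rewrite sumr_ge0// => ? _).
rewrite normr0 add0r; apply: ler_sum => i _; apply: ler_sum => j _.
rewrite raddf0 subr0 mxE (le_trans (ler_norm_sum _ _ _))//.
by apply: ler_sum => l _; rewrite !mxE normrM norm_conjC ler_pM.
Qed.

(** Moving [diag_fun f] across [L] multiplies the entry at [(x, y)] by [f x / f y], which is at most
    1 where [y <= x], the only place where [L] can be nonzero. *)
Lemma diag_fun_lower f (L : 'M_C[R, P]) :
  (forall x, 0 <= f x) -> order_decreasing f -> lower_mx L ->
  exists2 L', diag_fun f *m L = L' *m diag_fun f &
    forall i j, `|L' i j| <= `|L i j|.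
Proof.
move=> f0 fd Ll.
(* If f y = 0 and y <= x then f x = 0 as well, so the value 0 / 0 = 0 is harmless. *)
exists (\matrix_(i, j) ((f (enum_val i) / f (enum_val j))%:C * L i j)).
  apply/matrixP => i j; rewrite mul_diag_mx mul_mx_diag !mxE.
  have [le_ji|nle_ji] := boolP (enum_val j <= enum_val i)%O; last first.
    by have := Ll _ _ nle_ji; rewrite !enum_valK => ->; rewrite !mulr0 mul0r.
  have fij := fd _ _ le_ji.
  rewrite mulrAC -rmorphM /=; congr (_%:C * _).
  have [fj0|fj0] := eqVneq (f (enum_val j)) 0; last by rewrite divfK.
  by apply/eqP; rewrite fj0 mulr0 eq_le f0 andbT -fj0.
move=> i j; rewrite mxE.
have [le_ji|nle_ji] := boolP (enum_val j <= enum_val i)%O; last first.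
  by have := Ll _ _ nle_ji; rewrite !enum_valK => ->; rewrite mulr0.
have fij := fd _ _ le_ji.
rewrite normrM ler_piMl// ger0_norm ?ler0c ?divr_ge0// lecR.
have [fj0|fj0] := eqVneq (f (enum_val j)) 0; first by rewrite fj0 invr0 mulr0.
by rewrite ler_pdivrMr ?mul1r// lt0r fj0 f0.
Qed.

Lemma upper_mxT (U : 'M_C[R, P]) : upper_mx U -> lower_mx (U ^T).
Proof. by move=> Uu x y yx; rewrite mxE; exact: Uu. Qed.

Lemma diag_fun_upper f (U : 'M_C[R, P]) :
  (forall x, 0 <= f x) -> order_decreasing f -> upper_mx U ->
  exists2 U', U *m diag_fun f = diag_fun f *m U' &
    forall i j, `|U' i j| <= `|U i j|.
Proof.
move=> f0 fd /upper_mxT Ul; have [U' UE Ule] := diag_fun_lower f0 fd Ul.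
exists U'^T; last by move=> i j; rewrite mxE (le_trans (Ule _ _))// mxE.
apply: trmx_inj; rewrite !trmx_mul trmxK /diag_fun !tr_diag_mx.
exact: UE.
Qed.

(** [K] is fixed before [f] and [g], so that one constant serves all their powers. *)
Lemma gram_bound_lower_upper k (L U : 'M_C[R, P]) :
  lower_mx L -> upper_mx U ->
  exists2 K : R[i], 0 <= K & forall f g (c : R[i]),
    (forall x, 0 <= f x) -> (forall x, 0 <= g x) ->
    order_decreasing f -> order_decreasing g -> 0 <= c ->
    (forall h : {ffun 'I_k -> 'I_n}, injective h ->
      \prod_i ((f (enum_val (h i)) * g (enum_val (h i))) ^+ 2)%:C <= c) ->
    gram_bound k (diag_fun f *m (L *m U) *m diag_fun g) (K * c).
Proof.
move=> Ll Uu.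
pose N (Y : 'M_C[R, P]) := (\sum_i \sum_j \sum_l `|Y l i| * `|Y l j|) ^+ k.
have N0 Y : 0 <= N Y by rewrite exprn_ge0//; do 3! (apply: sumr_ge0 => ? _).
exists (N L * N U) => [|f g c f0 g0 fd gd c0 hc]; first exact: mulr_ge0.
have [L' fL L'L] := diag_fun_lower f0 fd Ll.
have [U' gU U'U] := diag_fun_upper g0 gd Uu.
rewrite mulmxA fL -!mulmxA gU -mulrA (mulrC (N U)) mulrA mulmxA mulmxA.
apply: gram_boundM; [exact: mulr_ge0| |exact: gram_bound_entry_le].
rewrite -mulmxA diag_funM; apply: gram_boundM => //.
  exact: gram_bound_entry_le.
exact: gram_bound_diag_fun.
Qed.

(** Iterated doubling gives [a ^+ (2 ^ j) <= b ^+ (2 ^ j - 1) * c]; the extra factor [b] on both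
    sides avoids the subtraction. *)
Lemma gram_eigen_doubling k f g (Y : 'M_C[R, P]) (b : R[i]) j :
  (k <= n)%N -> 0 <= b -> gram_bound k (Y ^t*) b ->
  forall a c, 0 <= a -> 0 <= c ->
    gram_eigen k (diag_fun f *m Y *m diag_fun g) a ->
    gram_bound k (diag_fun (fun x => f x ^+ (2 ^ j)) *m Y *m
                  diag_fun (fun x => g x ^+ (2 ^ j))) c ->
    a ^+ (2 ^ j) * b <= b ^+ (2 ^ j) * c.
Proof.
move=> kn b0 Yb; elim: j f g => [|j IH] f g a c a0 c0 aE cB.
  rewrite !expr1 mulrC ler_wpM2l//; exact: gram_bound_eigen cB aE.
pose f2 x := f x * f x; pose g2 x := g x * g x.
(* The sharp value [a'] is both a bound, as doubling requires, and an eigenvalue product, as the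
   induction hypothesis requires. *)
have [a' [a'0 a'B a'E]] := gram_sharp (diag_fun f2 *m Y *m diag_fun g2) kn.
have aa' : a ^+ 2 <= b * a'.
  apply: (gram_bound_doubling (diag_fun_conjT f) (diag_fun_conjT g)
    a0 b0 a'0 aE Yb).
  by rewrite !diag_funM.
have sqX (u : P -> R) : (fun x => (u x * u x) ^+ (2 ^ j)) =
    (fun x => u x ^+ (2 ^ j.+1)).
  by apply/funext => x; rewrite -expr2 -exprM expnS.
have := IH f2 g2 a' c a'0 c0 a'E; rewrite !sqX => /(_ cB) a'c.
rewrite expnS !exprM.
apply: (@le_trans _ _ ((b * a') ^+ (2 ^ j) * b)).
  by rewrite ler_wpM2r// lerXn2r// nnegrE ?exprn_ge0 ?mulr_ge0.
by rewrite exprMn -mulrA -exprM mulnC exprM expr2 -mulrA ler_wpM2l ?exprn_ge0.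
Qed.

Lemma gram_bound_diag_lower_upper k f g (Y : 'M_C[R, P]) (b c : R) :
  (k <= n)%N -> (forall x, 0 <= f x) -> (forall x, 0 <= g x) ->
  order_decreasing f -> order_decreasing g -> lower_upper_mx R P Y ->
  0 < b -> gram_bound k (Y ^t*) b%:C -> 0 <= c ->
  (forall h : {ffun 'I_k -> 'I_n}, injective h ->
    \prod_i (f (enum_val (h i)) * g (enum_val (h i))) ^+ 2 <= c) ->
  gram_bound k (diag_fun f *m Y *m diag_fun g) (b * c)%:C.
Proof.
move=> kn f0 g0 fd gd [L Ll [U Uu LU]] b0 Yb c0 hc.
have [K K0 KB] := gram_bound_lower_upper k Ll Uu.
rewrite LU in KB.
have [a [a0 aB aE]] := gram_sharp (diag_fun f *m Y *m diag_fun g) kn.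
have reC (z : R[i]) : 0 <= z -> z = (complex.Re z)%:C.
  by move=> /ger0_real/RRe_real.
have decrX (u : P -> R) j : (forall x, 0 <= u x) -> order_decreasing u ->
    order_decreasing (fun x => u x ^+ j).
  by move=> u0 ud x y xy; rewrite lerXn2r ?nnegrE// ud.
suff abc : a <= (b * c)%:C.
  by move=> Q; rewrite (le_trans (aB Q))// ler_wpM2r ?gram_ge0.
rewrite (reC _ a0) lecR.
(* The scalings [f ^+ (2 ^ j)] and [g ^+ (2 ^ j)] have bound [K * c ^+ (2 ^ j)], whence [a ^+ (2 ^
   j) * b <= K * (b * c) ^+ (2 ^ j)]. *)
apply: (@le_of_double_powers _ _ _ b (complex.Re K)) => // [||j].
- by rewrite -lecR -reC.
- by rewrite mulr_ge0// ltW.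
rewrite -lecR !rmorphM !rmorphXn /= -!reC//.
have b0' : 0 <= b%:C by rewrite ler0c ltW.
have := gram_eigen_doubling (j := j) kn b0' Yb a0 (c := K * (c ^+ (2 ^ j))%:C).
move=> /(_ f g) H.
have -> : K * (b * c)%:C ^+ (2 ^ j) = b%:C ^+ (2 ^ j) * (K * (c ^+ (2 ^ j))%:C).
  by rewrite rmorphM rmorphXn exprMn mulrCA.
apply: H => //; first by rewrite mulr_ge0// ler0c exprn_ge0.
apply: KB => //; do ?[by move=> x; exact: exprn_ge0|exact: decrX].
  by rewrite ler0c exprn_ge0.
move=> h hI; rewrite -rmorph_prod lecR.
under eq_bigr do rewrite -exprMn exprAC.
by rewrite prodrXl lerXn2r ?nnegrE ?prodr_ge0 ?hc// => i _; exact: sqr_ge0.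
Qed.

Lemma gram_bound_diag_closure k f g (Y : 'M_C[R, P]) (c : R) :
  (k <= n)%N -> (forall x, 0 <= f x) -> (forall x, 0 <= g x) ->
  order_decreasing f -> order_decreasing g ->
  mx_closure (lower_upper_mx R P) Y -> Y \is unitarymx -> 0 <= c ->
  (forall h : {ffun 'I_k -> 'I_n}, injective h ->
    \prod_i (f (enum_val (h i)) * g (enum_val (h i))) ^+ 2 <= c) ->
  gram_bound k (diag_fun f *m Y *m diag_fun g) c%:C.
Proof.
move=> kn f0 g0 fd gd Ycl Yu c0 hc Q.
(* Matrices approximating [Y] may fail to be unitary; [eta X] bounds [X ^t*], is continuous in [X],
   and equals 1 at [Y]. *)
pose eta (X : 'M_C[R, P]) : R[i] :=
  (1 + \sum_i \sum_j `|(X *m X ^t* - 1%:M) i j|) ^+ k.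
pose h (X : 'M_C[R, P]) : R[i] := eta X * (c%:C * gram Q)
  - gram (diag_fun f *m X *m diag_fun g *m Q).
have eta_ge0 X : 0 < eta X.
  rewrite exprn_gt0// ltr_pwDl// sumr_ge0// => i _; exact: sumr_ge0.
have hge0 X : lower_upper_mx R P X -> 0 <= h X.
  move=> XLU; rewrite subr_ge0 mulrA.
  have eE : eta X = (complex.Re (eta X))%:C.
    by rewrite RRe_real// ger0_real// ltW.
  rewrite eE -rmorphM; apply: gram_bound_diag_lower_upper => //.
    by rewrite -ltcR -eE.
  rewrite -eE => Q'; apply: le_trans (gram_bound_dist _ 1 Q') _.
  by rewrite trmxCK normr1.
have hY : h Y = c%:C * gram Q - gram (diag_fun f *m Y *m diag_fun g *m Q).
  rewrite /h /eta (unitarymxP Yu) subrr.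
  by under eq_bigr do under eq_bigr do rewrite mxE normr0;
    rewrite !big1_eq ?addr0 ?expr1n ?mul1r// big1// => ? _; rewrite big1_eq.
rewrite -subr_ge0 -hY.
have hreal : h Y \is Num.real.
  by rewrite realB// ger0_real ?gram_ge0// ?mulr_ge0 ?gram_ge0 ?ler0c// ltW.
apply: (@ge0_closure R[i] 'M[R[i] : numFieldType]_n _ h Y Ycl) => //.
apply: (@cvg_gram_defect R[i] _ _
  (nbhs_filter (Y : 'M[R[i] : numFieldType]_n))) => i j.
exact: coord_continuous.
Qed.

End DiagFun.

(** * Decreasing rearrangements and products of the largest entries *)

Section DecreasingRearrangement.
Variables (R : realType) (n : nat).
Implicit Types (x y : 'rV[R]_n).

Lemma decr_rearr_perm x :
  exists p : 'S_n, forall i, decr_rearr x 0 i = x 0 (p i).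
Proof.
have : perm_eq (sort >=%R [tuple x 0 j | j < n]) [tuple x 0 j | j < n].
  by rewrite perm_sort.
case/tuple_permP => p pE; exists p => i; rewrite mxE.
rewrite [sort _ _]pE (nth_map i) ?size_enum_ord// nth_ord_enum tnth_mktuple.
by [].
Qed.

Lemma decr_rearr_anti x (i j : 'I_n) :
  (i <= j)%N -> decr_rearr x 0 j <= decr_rearr x 0 i.
Proof.
have sz : size (sort >=%R [seq x 0 l | l <- enum 'I_n]) = n.
  by rewrite size_sort size_map size_enum_ord.
have sorted_x := sort_sorted (@ge_total _ R) [seq x 0 l | l <- enum 'I_n].
move=> ij; rewrite !mxE.
by apply: (sorted_leq_nth ge_trans ge_refl 0 sorted_x); rewrite ?inE ?sz.
Qed.

Lemma decr_rearr_unique x y (p : 'S_n) :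
  (forall i, y 0 i = x 0 (p i)) ->
  (forall i j : 'I_n, (i <= j)%N -> y 0 j <= y 0 i) -> decr_rearr x = y.
Proof.
move=> yx ydec; apply/rowP => i; rewrite mxE.
suff -> : sort >=%R [seq x 0 j | j <- enum 'I_n] = [seq y 0 j | j <- enum 'I_n].
  by rewrite (nth_map i) ?size_enum_ord// nth_ord_enum.
have /(sorted_sort ge_trans) <- : sorted >=%R [seq y 0 j | j <- enum 'I_n].
  apply: (path.homo_sorted (e := fun i j : 'I_n => (i <= j)%N)).
    by move=> a b /ydec.
  by have := iota_sorted 0 n; rewrite -val_enum_ord sorted_map.
apply/perm_sortP; [exact: ge_total|exact: ge_trans|exact: ge_anti|].
rewrite perm_sym.
have -> : [seq y 0 j | j <- enum 'I_n] =
    map (tnth [tuple x 0 j | j < n] \o p) (enum 'I_n).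
  by apply: eq_map => j; rewrite /= tnth_mktuple.
by apply/(@tuple_permP _ n _ [tuple x 0 j | j < n]); exists p.
Qed.

Lemma decr_rearr_id x :
  (forall i j : 'I_n, (i <= j)%N -> x 0 j <= x 0 i) -> decr_rearr x = x.
Proof. by apply: (decr_rearr_unique (p := 1%g)) => i; rewrite perm1. Qed.

Lemma decr_rearrK x : decr_rearr (decr_rearr x) = decr_rearr x.
Proof. by apply: decr_rearr_id; exact: decr_rearr_anti. Qed.

Lemma decr_rearr_map (phi : R -> R) x : {homo phi : a b / a <= b} ->
  decr_rearr (map_mx phi x) = map_mx phi (decr_rearr x).
Proof.
move=> phi_le; have [p px] := decr_rearr_perm x.
apply: (decr_rearr_unique (p := p)) => [i|i j ij]; rewrite !mxE.
  by have := px i; rewrite mxE => ->.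
by apply: phi_le; have := decr_rearr_anti x ij; rewrite !mxE.
Qed.

Lemma decr_rearr_ge0 x :
  (forall i, 0 <= x 0 i) -> forall i, 0 <= decr_rearr x 0 i.
Proof. by move=> x0 i; have [p ->] := decr_rearr_perm x. Qed.

Lemma prod_decr_rearr x : \prod_i decr_rearr x 0 i = \prod_i x 0 i.
Proof.
have [p px] := decr_rearr_perm x.
by rewrite [RHS](reindex_inj (@perm_inj _ p)); apply: eq_bigr.
Qed.

(** Common factors are split off. The others are compared through the last of the first [k] entries:
    those from [S] are at most this value, and the equally many they replace are at least it. *)
Lemma prod_anti_set_le k y (S : {set 'I_n}) :
  (forall i, 0 <= y 0 i) ->
  (forall i j : 'I_n, (i <= j)%N -> y 0 j <= y 0 i) ->
  (k <= n)%N -> #|S| = k ->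
  \prod_(i in S) y 0 i <= \prod_(i < n | (i < k)%N) y 0 i.
Proof.
case: k => [|k] y0 ydec kn Sk.
  rewrite (cards0_eq Sk) big_set0 big_pred0//.
pose T := [set i : 'I_n | (i < k.+1)%N]; pose c := y 0 (Ordinal kn).
have c0 : 0 <= c by exact: y0.
have -> : \prod_(i < n | (i < k.+1)%N) y 0 i = \prod_(i in T) y 0 i.
  by apply: eq_bigl => i; rewrite inE.
have TE : #|T| = k.+1.
  by rewrite cardsE -sum1_card (big_ord_narrow kn) sum_nat_const card_ord muln1.
have ST : #|S :\: T| = #|T :\: S|.
  by apply/eqP; rewrite -(eqn_add2l #|S :&: T|) cardsID finset.setIC cardsID Sk TE.
rewrite (big_setID T) [leRHS](big_setID S) /= finset.setIC.
rewrite ler_wpM2l ?prodr_ge0//.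
apply: (@le_trans _ _ (\prod_(i in S :\: T) c)).
  apply: ler_prod => i; rewrite !inE -leqNgt => /andP[ki _].
  by rewrite y0 ydec// ltnW.
rewrite prodr_const ST -prodr_const; apply: ler_prod => i.
by rewrite !inE ltnS => /andP[_ ik]; rewrite c0 ydec.
Qed.

Lemma prod_inj_le_decr_rearr k x (f : 'I_k -> 'I_n) :
  (forall i, 0 <= x 0 i) -> injective f ->
  \prod_i x 0 (f i) <= \prod_(i < n | (i < k)%N) decr_rearr x 0 i.
Proof.
move=> x0 fI; have [p px] := decr_rearr_perm x.
pose g i := (p^-1)%g (f i).
have gI : injective g by move=> i j /perm_inj/fI.
have -> : \prod_i x 0 (f i) = \prod_(i in g @: 'I_k) decr_rearr x 0 i.
  rewrite big_imset /=; last by move=> i j _ _; exact: gI.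
  by apply: eq_big => // i _; rewrite px permKV.
apply: prod_anti_set_le.
- exact: decr_rearr_ge0.
- exact: decr_rearr_anti.
- by rewrite -(card_ord k) -[in leqRHS](card_ord n); exact: leq_card gI.
- by rewrite card_imset// card_ord.
Qed.

Lemma prod_decr_rearr_inj k x : (k <= n)%N ->
  exists2 f : 'I_k -> 'I_n, injective f &
    \prod_(i < n | (i < k)%N) decr_rearr x 0 i = \prod_i x 0 (f i).
Proof.
move=> kn; have [p px] := decr_rearr_perm x.
exists (fun i => p (widen_ord kn i)).
  by move=> i j /perm_inj/(congr1 val)/= /val_inj.
by rewrite (big_ord_narrow kn); apply: eq_bigr => i _; rewrite px.
Qed.

End DecreasingRearrangement.

(** * Eigenvalues and singular values from unitary diagonalizations *)

Section SpectraOfDiagonalizable.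
Local Open Scope complex_scope.
Local Open Scope sesquilinear_scope.
Variables (R : realType) (n : nat).
Implicit Types (X U : 'M[R[i]]_n) (s : 'rV[R]_n).

(** Equal characteristic polynomials make [eigenvalues X] a permutation of the entries of [s], and
    sorting removes the ambiguity. *)
Lemma herm_eigenvalues_diag X U s : U \is unitarymx ->
  X = U ^t* *m diag_mx (map_mx (real_complex R) s) *m U ->
  herm_eigenvalues X = decr_rearr s.
Proof.
move=> Uu XE.
have : perm_eq (eigenvalues X) [seq (s 0 i)%:C | i <- enum 'I_n].
  apply: prod_XsubC_eq; rewrite -eigenvaluesE.
  rewrite (char_poly_unitary_conj Uu XE) char_poly_trig ?diag_mx_is_trig//.
  by rewrite big_map big_enum; apply: eq_bigr => i _; rewrite !mxE eqxx.
move=> /(perm_map (@complex.Re R)); rewrite -map_comp => eX.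
apply/rowP => i; rewrite !mxE; congr (_`_i).
apply/perm_sortP; [exact: ge_total|exact: ge_trans|exact: ge_anti|].
suff -> : [seq (\row_l complex.Re (eigenvalues X)`_l) 0 j | j <- enum 'I_n]
    = [seq complex.Re z | z <- eigenvalues X] by [].
apply: (@eq_from_nth _ 0) => [|j].
  by rewrite size_map size_enum_ord size_map size_eigenvalues.
rewrite size_map size_enum_ord => jn.
rewrite (nth_map (Ordinal jn)) ?size_enum_ord// mxE nth_enum_ord//.
by rewrite (nth_map 0)// size_eigenvalues.
Qed.

Lemma gramian_spectral X : exists (U : 'M[R[i]]_n) s,
  [/\ U \is unitarymx, forall i, 0 <= s 0 i,
      X ^t* *m X = U ^t* *m diag_mx (map_mx (real_complex R) s) *m U &
      forall i, singular_values X 0 i = Num.sqrt (decr_rearr s 0 i)].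
Proof.
have [U [s [Uu XE s0]]] := spectral_gramian X.
have sE : s = map_mx (real_complex R) (map_mx (@complex.Re R) s).
  by apply/rowP => i; rewrite !mxE RRe_real// ger0_real.
rewrite sE in XE; exists U, (map_mx (@complex.Re R) s); split=> // i.
  by rewrite mxE -lecR RRe_real// ger0_real.
by rewrite mxE (herm_eigenvalues_diag Uu XE).
Qed.

Lemma decr_rearr_singular_values X :
  decr_rearr (singular_values X) = singular_values X.
Proof.
by rewrite /singular_values decr_rearr_map ?decr_rearrK//; exact: ler_wsqrtr.
Qed.

End SpectraOfDiagonalizable.

(** * Spectra of diagonal matrices and of singular value decompositions *)

Section DiagFunSpectra.
Local Open Scope complex_scope.
Local Open Scope sesquilinear_scope.
Variables (R : realType) (d : Order.disp_t) (P : finPOrderType d).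
Local Notation n := #|P|.
Implicit Types (f : P -> R).

Definition row_fun f : 'rV[R]_n := \row_j f (enum_val j).

Lemma herm_eigenvalues_diag_fun f :
  herm_eigenvalues (diag_fun f) = decr_rearr (row_fun f).
Proof.
apply: (@herm_eigenvalues_diag _ _ _ 1%:M).
  by apply/unitarymxP; rewrite trmx1 map_mx1 mulmx1.
rewrite trmx1 map_mx1 mul1mx mulmx1; congr diag_mx.
by apply/rowP => i; rewrite !mxE.
Qed.

(** The Gramian is diagonalized by [W] with entries [f x ^+ 2], and the monotone square root
    commutes with rearrangement. *)
Lemma singular_values_svd f (V W : 'M_C[R, P]) :
  (forall x, 0 <= f x) -> V \is unitarymx -> W \is unitarymx ->
  singular_values (V *m diag_fun f *m W) = decr_rearr (row_fun f).
Proof.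
move=> f0 Vu Wu; rewrite /singular_values.
rewrite (@herm_eigenvalues_diag _ _ _ W (row_fun (fun x => f x ^+ 2)))//.
  rewrite -decr_rearr_map; last exact: ler_wsqrtr.
  by congr decr_rearr; apply/rowP => i; rewrite !mxE sqrtr_sqr ger0_norm.
move: Vu; rewrite -trmxC_unitary => /unitarymxP; rewrite trmxCK => Vu.
rewrite !conjT_mul diag_fun_conjT -!mulmxA (mulmxA _ V) Vu mul1mx.
rewrite (mulmxA (diag_fun f)) diag_funM; congr (_ *m (diag_mx _ *m _)).
by apply/rowP => i; rewrite !mxE expr2.
Qed.

Lemma det_diag_fun f : \det (diag_fun f) = (\prod_i row_fun f 0 i)%:C.
Proof.
by rewrite det_diag rmorph_prod; apply: eq_bigr => i _; rewrite !mxE.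
Qed.

End DiagFunSpectra.

(** * Products of the singular values of a matrix product *)

Section Products.
Local Open Scope complex_scope.
Local Open Scope sesquilinear_scope.
Variables (R : realType) (d : Order.disp_t) (P : finPOrderType d).
Variables (f g : P -> R) (V W V' W' : 'M_C[R, P]).
Hypotheses (f_ge0 : forall x, 0 <= f x) (g_ge0 : forall x, 0 <= g x).
Hypotheses (V_unitary : V \is unitarymx) (W_unitary : W \is unitarymx).
Hypotheses (V'_unitary : V' \is unitarymx) (W'_unitary : W' \is unitarymx).
Local Notation n := #|P|.
Local Notation fg := (row_fun (fun x => f x * g x)).
Local Notation AB := (V *m diag_fun f *m W *m (V' *m diag_fun g *m W')).

Let ABE : AB = V *m (diag_fun f *m (W *m V') *m diag_fun g) *m W'.
Proof. by rewrite !mulmxA. Qed.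

Let fg_ge0 i : 0 <= fg 0 i.
Proof. by rewrite mxE mulr_ge0. Qed.

(** In squares: [m ^+ 2] is a Gram bound of the product, and the [k] largest eigenvalues of its
    Gramian form an eigenvalue product, which cannot exceed it. *)
Lemma prod_singular_values_mul_le k :
  order_decreasing f -> order_decreasing g ->
  mx_closure (lower_upper_mx R P) (W *m V') -> (k <= n)%N ->
  \prod_(i < n | (i < k)%N) singular_values AB 0 i
    <= \prod_(i < n | (i < k)%N) decr_rearr fg 0 i.
Proof.
move=> fd gd LU kn.
have [U [s [Uu s0 XE svE]]] := gramian_spectral AB.
have [h hI hE] := prod_decr_rearr_inj s kn.
set m := \prod_(i < n | _) decr_rearr fg 0 i.
have m0 : 0 <= m by apply: prodr_ge0 => i _; exact: decr_rearr_ge0.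
have bnd : gram_bound k AB (m ^+ 2)%:C.
  rewrite ABE; apply: (gram_bound_unitaryM V_unitary W'_unitary).
  have C_unitary := mul_unitarymx W_unitary V'_unitary.
  apply: (gram_bound_diag_closure kn f_ge0 g_ge0 fd gd LU C_unitary).
    exact: exprn_ge0.
  move=> t tI; rewrite prodrXl lerXn2r ?nnegrE// ?prodr_ge0//.
    by move=> i _; rewrite mulr_ge0.
  have := prod_inj_le_decr_rearr fg_ge0 tI.
  by under eq_bigr do rewrite mxE.
have := gram_bound_eigen bnd (gram_eigen_spectral Uu XE hI).
under eq_bigr do rewrite mxE.
rewrite -rmorph_prod lecR -hE => le_m.
rewrite -(ler_pXn2r (n := 2))// ?nnegrE//; last first.
  by apply: prodr_ge0 => i _; rewrite svE sqrtr_ge0.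
rewrite -prodrXl (eq_bigr (decr_rearr s 0)) => [//|i _].
by rewrite svE sqr_sqrtr// decr_rearr_ge0.
Qed.

(** Both sides are nonnegative with square [|\det AB| ^+ 2], since unitary factors have determinant
    of modulus 1. *)
Lemma prod_singular_values_mul :
  \prod_i singular_values AB 0 i = \prod_i fg 0 i.
Proof.
have [U [s [Uu s0 XE svE]]] := gramian_spectral AB.
apply/eqP; rewrite -(@eqrXn2 _ 2)//; last 2 first.
- by apply: prodr_ge0 => i _; rewrite svE sqrtr_ge0.
- exact: prodr_ge0.
have -> : (\prod_i singular_values AB 0 i) ^+ 2 = \prod_i s 0 i.
  rewrite -prodrXl -(prod_decr_rearr s); apply: eq_bigr => i _.
  by rewrite svE sqr_sqrtr// decr_rearr_ge0.
have prod0 (u : P -> R) : (forall x, 0 <= u x) -> 0 <= \prod_i row_fun u 0 i.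
  by move=> u0; apply: prodr_ge0 => i _; rewrite mxE.
have detAB : `|\det AB| = (\prod_i fg 0 i)%:C.
  rewrite !det_mulmx !normrM (norm_det_unitary V_unitary)
    (norm_det_unitary W_unitary) (norm_det_unitary V'_unitary)
    (norm_det_unitary W'_unitary) !mul1r !mulr1 !det_diag_fun.
  rewrite !ger0_norm ?ler0c ?prod0// -rmorphM -big_split /=; congr (_%:C).
  by apply: eq_bigr => i _; rewrite !mxE.
apply/eqP/complexI; move/(congr1 determinant): XE.
rewrite det_mulmx det_conjT -normCKC detAB -rmorphXn => ->.
rewrite !det_mulmx det_conjT mulrAC -normCKC (norm_det_unitary Uu).
rewrite expr1n mul1r det_diag rmorph_prod.
by apply: eq_bigr => i _; rewrite mxE.
Qed.

End Products.

(** * The two log-majorizations *)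

Unset Implicit Arguments.

Theorem theorem3 (R : realType) (d : Order.disp_t) (P : finPOrderType d)
    (alpha beta : P -> R)
    (alpha_ge0 : forall x, 0 <= alpha x) (beta_ge0 : forall x, 0 <= beta x)
    (alpha_decr : order_decreasing alpha) (beta_decr : order_decreasing beta)
    (A B V W V' W' : 'M_C[R, P])
    (V_unitary : V \is unitarymx) (W_unitary : W \is unitarymx)
    (V'_unitary : V' \is unitarymx) (W'_unitary : W' \is unitarymx)
    (svdA : A = V *m diag_fun alpha *m W)
    (svdB : B = V' *m diag_fun beta *m W')
    (closure_LU : mx_closure (lower_upper_mx R P) (W *m V')) :
  log_majorized (singular_values (A *m B))
                (herm_eigenvalues (diag_fun (fun x => alpha x * beta x)))
  /\ log_majorized (herm_eigenvalues (diag_fun (fun x => alpha x * beta x)))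
                   (map2_mx *%R (singular_values A) (singular_values B)).
Proof.
have sA : singular_values A = decr_rearr (row_fun alpha).
  by rewrite svdA singular_values_svd.
have sB : singular_values B = decr_rearr (row_fun beta).
  by rewrite svdB singular_values_svd.
have row_ge0 (u : P -> R) : (forall x, 0 <= u x) -> forall i, 0 <= row_fun u 0 i.
  by move=> u0 i; rewrite mxE.
(* A componentwise product of decreasing nonnegative vectors is decreasing, so it is its own
   rearrangement. *)
have sAB_id : decr_rearr (map2_mx *%R (singular_values A) (singular_values B))
    = map2_mx *%R (singular_values A) (singular_values B).
  apply: decr_rearr_id => i j ij; rewrite sA sB [leLHS]mxE [leRHS]mxE.
  by apply: ler_pM; rewrite ?decr_rearr_ge0 ?decr_rearr_anti//; exact: row_ge0.
rewrite /log_majorized decr_rearr_singular_values herm_eigenvalues_diag_fun.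
rewrite decr_rearrK sAB_id; split; split.
- by move=> k /andP[_ kn]; rewrite svdA svdB; exact: prod_singular_values_mul_le.
- by rewrite svdA svdB prod_singular_values_mul// prod_decr_rearr.
- move=> k /andP[_ kn].
  (* The [k] largest values of [alpha x * beta x] sit at distinct indices [h i]; the product over
     them splits, and each factor is at most the product of the [k] largest values of its own
     function. *)
  have [h hI ->] := prod_decr_rearr_inj (row_fun (fun x => alpha x * beta x)) kn.
  under eq_bigr do rewrite mxE.
  rewrite [leRHS](eq_bigr (fun i => decr_rearr (row_fun alpha) 0 i
    * decr_rearr (row_fun beta) 0 i)) => [|i _]; last by rewrite mxE sA sB.
  rewrite !big_split /=.
  have bound (u : P -> R) : (forall x, 0 <= u x) ->
      \prod_i u (enum_val (h i)) <=
      \prod_(i < #|P| | (i < k)%N) decr_rearr (row_fun u) 0 i.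
    move=> u0; have := prod_inj_le_decr_rearr (row_ge0 u u0) hI.
    by under eq_bigr do rewrite mxE.
  by apply: ler_pM; rewrite ?bound// prodr_ge0.
- under [RHS]eq_bigr do rewrite mxE sA sB.
  rewrite big_split /= !prod_decr_rearr -big_split /=.
  by apply: eq_bigr => i _; rewrite !mxE.
Qed.
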